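(* Let $G=(V,E)$ be an $L$-graph and let $\mathcal{M}=\{\mathcal{M}_\mu\in\mathcal{P}(V):\mu=1,\dots,k\}$ be a finite collection of nonempty, pairwise disjoint and weakly invariant sets of the semiflow $\Phi_G$ on $\mathcal{P}(V)$. Then $\mathcal{M}$ is a Morse decomposition of $\Phi_G$ if and only if the following two properties hold: (1) $\mathcal{R}\subset\bigcup_{\mu=1}^k\mathcal{M}_\mu$, where $\mathcal{R}$ is the recurrent set of $\Phi_G$; (2) the relation $\preceq$ on $\mathcal{M}$ defined by: $\mathcal{M}_\alpha\preceq\mathcal{M}_\beta$ if there are $\mathcal{M}_{j_0}=\mathcal{M}_\alpha,\mathcal{M}_{j_1},\dots,\mathcal{M}_{j_l}=\mathcal{M}_\beta$ in $\mathcal{M}$ (with $l\ge 1$) such that $\omega(\mathcal{M}_{j_i})\cap\mathcal{M}_{j_{i+1}}\neq\varnothing$ for $i=0,\dots,l-1$, is a (partial) order on $\mathcal{M}$.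
   Context: A graph $G=(V,E)$ is a finite directed graph without multiple edges, $E\subset V\times V$; it is an $L$-graph if every vertex has at least one outgoing edge. A path of length $n\ge 0$ is a sequence of vertices $\gamma=\langle i_0\ldots i_n\rangle$ with $(i_p,i_{p+1})\in E$ for $0\le p<n$. The semiflow of $G$ is $\Phi_G:\mathbb{N}\times\mathcal{P}(V)\to\mathcal{P}(V)$ ($\mathbb{N}=\{0,1,\dots\}$), where $\Phi_G(n,A)$ is the set of $j\in V$ for which there is a path of length $n$ from some $i\in A$ to $j$. A set $A\in\mathcal{P}(V)$ is weakly invariant if $\Phi_G(n,A)\cap A\ne\varnothing$ for all $n\in\mathbb{N}$. The $\omega$-limit set is $\omega(A)=\{y\in V:\text{ there are } t_k\to\infty \text{ with } y\in\Phi_G(t_k,A)\}$. A one-point set $\{i\}$ is recurrent if there is a sequence $n_l\to\infty$ in $\mathbb{N}$ with $i\in\Phi_G(n_l,\{i\})$; the recurrent set is $\mathcal{R}=\{i\in V:\{i\}\text{ is recurrent}\}$. A finite collection $\mathcal{A}\subset\mathcal{P}(V)$ satisfies the no-cycle condition if for any $l\ge1$ and any members $A_{j_0},\dots,A_{j_l}$ of $\mathcal{A}$, not all equal, with $\omega(A_{j_\alpha})\cap A_{j_{\alpha+1}}\ne\varnothing$ for $\alpha=0,\dots,l-1$, one has $A_{j_0}\neq A_{j_l}$. A Morse decomposition of $\Phi_G$ is a finite collection of nonempty, pairwise disjoint, weakly invariant sets $\mathcal{M}_\mu\in\mathcal{P}(V)$, $\mu=1,\dots,k$, such that $\mathcal{R}\subset\bigcup_\mu\mathcal{M}_\mu$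 and the collection satisfies the no-cycle condition. *)

(* Defs.v *)
From mathcomp Require Import all_boot.
From mathcomp Require Import boolp classical_sets filter.
From Stdlib Require Relation_Definitions.
(* [set0], [trivIset], [cover], ... denote the notions of finset below, not
   their namesakes of classical_sets. *)
From mathcomp Require Import finset.

Set Implicit Arguments.
Unset Strict Implicit.
Unset Printing Implicit Defensive.

Definition Lgraph (V : finType) (E : rel V) : Prop :=
  forall i : V, exists j : V, E i j.

(* A path <i_0 ... i_n> is represented by its source i_0 together with the
   n-tuple of the remaining vertices. *)
Definition semiflow (V : finType) (E : rel V) (n : nat) (A : {set V}) :
    {set V} :=
  [set j | [exists i in A, exists p : n.-tuple V,
              path E i p && (last i p == j)]].

Definition weakly_invariant (V : finType) (E : rel V) (A : {set V}) : Prop :=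
  forall n : nat, semiflow E n A :&: A != set0.

Definition omega_limit (V : finType) (E : rel V) (A : {set V}) : {set V} :=
  [set y | `[< exists t : nat -> nat,
      (t @ \oo --> \oo)%classic /\
      forall k : nat, y \in semiflow E (t k) A >]].

Definition recurrent (V : finType) (E : rel V) (i : V) : Prop :=
  exists n : nat -> nat,
    (n @ \oo --> \oo)%classic /\
    forall l : nat, i \in semiflow E (n l) [set i].

Definition recurrent_set (V : finType) (E : rel V) : {set V} :=
  [set i | `[< recurrent E i >]].

(* Only the members C 0, ..., C l of the sequence C are relevant. *)
Definition omega_chain (V : finType) (E : rel V) (M : {set {set V}})
    (l : nat) (C : nat -> {set V}) : Prop :=
  (forall a : nat, a <= l -> C a \in M) /\
  (forall a : nat, a < l -> omega_limit E (C a) :&: C a.+1 != set0).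

Definition no_cycle (V : finType) (E : rel V) (M : {set {set V}}) : Prop :=
  forall (l : nat) (C : nat -> {set V}),
    1 <= l -> omega_chain E M l C ->
    ~ (forall a b : nat, a <= l -> b <= l -> C a = C b) ->
    C 0 <> C l.

Definition morse_decomposition (V : finType) (E : rel V)
    (M : {set {set V}}) : Prop :=
  [/\ forall A : {set V}, A \in M -> A != set0,
      trivIset M,
      forall A : {set V}, A \in M -> weakly_invariant E A,
      recurrent_set E \subset cover M
    & no_cycle E M].

Definition morse_le (V : finType) (E : rel V) (M : {set {set V}})
    (A B : {X : {set V} | X \in M}) : Prop :=
  exists (l : nat) (C : nat -> {set V}),
    [/\ 1 <= l, omega_chain E M l C, C 0 = sval A & C l = sval B].
Arguments morse_le {V} E M A B.

Definition is_partial_order (T : Type) (R : T -> T -> Prop) : Prop :=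
  Relation_Definitions.order T R.

(* Main.v *)
From mathcomp Require Import boolp classical_sets filter.
Require Import Defs.
From mathcomp Require Import all_boot.

(** Since V is finite, a weakly invariant set A returns infinitely often to one
    of its own points, so [omega A] meets [A]; this makes the chain relation
    reflexive. Transitivity is concatenation of chains, and antisymmetry is a
    restatement of the no-cycle condition: the members of a closed chain are
    all equivalent for the chain preorder. *)

Lemma cvg_nat_oo_ge_id (t : nat -> nat) :
  (forall k, k <= t k) -> (t @ \oo --> \oo)%classic.
Proof.
move=> tge P [N _ NP]; exists N => // n /= Nn.
by apply: NP => /=; apply: leq_trans Nn (tge n).
Qed.

Section Chains.
Context {V : finType} (E : rel V).
Implicit Types (A : {set V}) (M : {set {set V}}) (C : nat -> {set V}).

(** Choosing for each [N] a visit time at least [N] gives a sequence of times that dominates the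
    identity, hence tends to infinity. *)
Lemma in_omega_limit A y :
  (forall N, exists2 n, N <= n & y \in semiflow E n A) -> y \in omega_limit E A.
Proof.
move=> often; rewrite inE; apply/asboolP.
have /choice[t tP] N : exists n, N <= n /\ y \in semiflow E n A.
  by have [n ? ?] := often N; exists n.
exists t; split=> [|k]; last by have [] := tP k.
by apply: cvg_nat_oo_ge_id => k; have [] := tP k.
Qed.

(** Otherwise each [y] in [A] is missed from some time [N y] on, and weak invariance fails at the
    maximum of these times. *)
Lemma weakly_invariant_omega_limit A :
  weakly_invariant E A -> omega_limit E A :&: A != set0.
Proof.
move=> Ainv; apply/negP => /eqP omega0.
(* The premise [y \in A] makes the bound vacuous off [A], so that [N] is total on [V] and its
   maximum can be taken. *)
have /choice[N NP] y :
    exists N, forall n, N <= n -> y \in A -> y \notin semiflow E n A.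
  apply: contrapT => /forallNP nobound.
  have yA : y \in A.
    apply: contrapT => yA; apply: (nobound 0) => n _ yA'.
    by case: yA.
  have : y \in omega_limit E A :&: A.
    rewrite in_setI yA andbT; apply: in_omega_limit => N.
    apply: contrapT => none; apply: (nobound N) => n Nn _.
    by apply/negP => yn; apply: none; exists n.
  by rewrite omega0 in_set0.
have /set0Pn[y] := Ainv (\max_y N y).
rewrite in_setI => /andP[yn yA].
by have := NP y _ (leq_bigmax y) yA; rewrite yn.
Qed.

(** The junction index [l] is read from [C], so [C' 0] never appears; gluing is sound when
    [C l = C' 0]. *)
Definition chain_cat (l : nat) C C' : nat -> {set V} :=
  fun a => if a <= l then C a else C' (a - l).

Lemma chain_cat_end l l' C C' :
  C l = C' 0 -> chain_cat l C C' (l + l') = C' l'.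
Proof.
rewrite /chain_cat; case: l' => [|l'] eqC; first by rewrite addn0 leqnn.
by rewrite leqNgt -addSnnS leq_addr /= addSnnS addKn.
Qed.

Lemma omega_chain_cat M l l' C C' :
  omega_chain E M l C -> omega_chain E M l' C' -> C l = C' 0 ->
  omega_chain E M (l + l') (chain_cat l C C').
Proof.
move=> [CM Cw] [CM' Cw'] eqC; split=> a a_le; rewrite /chain_cat.
  case: leqP => al; first exact: CM.
  by apply: CM'; rewrite leq_subLR.
case: (ltngtP a l) => al; first exact: Cw.
  by rewrite subSn 1?ltnW //; apply: Cw'; rewrite ltn_subLR // ltnW.
rewrite al subSnn eqC; apply: Cw'.
by move: a_le; rewrite al -{1}[l]addn0 ltn_add2l.
Qed.

Lemma omega_chain_prefix M l C a :
  a <= l -> omega_chain E M l C -> omega_chain E M a C.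
Proof.
move=> al [CM Cw]; split=> b ba; first exact/CM/(leq_trans ba).
exact/Cw/(leq_trans ba).
Qed.

Lemma omega_chain_suffix M l C a :
  a <= l -> omega_chain E M l C ->
  omega_chain E M (l - a) (fun b => C (a + b)).
Proof.
move=> al [CM Cw]; split=> b ba.
  by apply: CM; rewrite -(subnKC al) leq_add2l.
by rewrite addnS; apply: Cw; rewrite -(subnKC al) ltn_add2l.
Qed.

Lemma morse_le_refl M (A : {X : {set V} | X \in M}) :
  weakly_invariant E (sval A) -> morse_le E M A A.
Proof.
(* A chain needs at least one link, so the witness is the constant chain of length 1. *)
move=> Ainv; exists 1, (fun=> sval A); split=> //; split=> a _.
  exact: (svalP A).
exact: weakly_invariant_omega_limit.
Qed.

Lemma morse_le_trans M (A B D : {X : {set V} | X \in M}) :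
  morse_le E M A B -> morse_le E M B D -> morse_le E M A D.
Proof.
move=> [l [C [l1 Cc C0 Cl]]] [l' [C' [l1' Cc' C0' Cl']]].
have eqC : C l = C' 0 by rewrite Cl C0'.
exists (l + l'), (chain_cat l C C'); split.
- by rewrite addn_gt0 l1.
- exact: omega_chain_cat.
- by rewrite /chain_cat.
- by rewrite chain_cat_end.
Qed.

Lemma no_cycle_morse_le_anti M (A B : {X : {set V} | X \in M}) :
  no_cycle E M -> morse_le E M A B -> morse_le E M B A -> A = B.
Proof.
move=> nc [l [C [l1 Cc C0 Cl]]] [l' [C' [l1' Cc' C0' Cl']]].
have eqC : C l = C' 0 by rewrite Cl C0'.
apply: val_inj; apply: contrapT => neqAB.
apply: (nc (l + l') (chain_cat l C C')).
- by rewrite addn_gt0 l1.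
- exact: omega_chain_cat.
(* Entries 0 and [l] of the closed chain are [A] and [B], assumed distinct. *)
- move=> /(_ 0 l (leq0n _) (leq_addr _ _)).
  by rewrite /chain_cat leqnn /= C0 Cl.
- by rewrite chain_cat_end // Cl' -C0.
Qed.

(** Cutting a closed chain at an inner member gives a prefix from [C 0] to it and a suffix from it
    back to [C l = C 0]; antisymmetry identifies it with [C 0]. *)
Lemma morse_le_anti_no_cycle M :
  (forall A B : {X : {set V} | X \in M},
     morse_le E M A B -> morse_le E M B A -> A = B) ->
  no_cycle E M.
Proof.
move=> anti l C l1 Cc neqC eqC; apply: neqC.
suff C0 a : a <= l -> C a = C 0 by move=> a b al bl; rewrite !C0.
(* The cases [a = l] and [a = 0] are set apart: there one of the two pieces would have length 0,
   which [morse_le] excludes. *)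
case: (ltngtP a l) => // [al _|-> //].
case: a al => // a al.
have [CM _] := Cc.
have CaM := CM _ (ltnW al); have C0M := CM 0 isT.
have le0a : morse_le E M (exist _ (C 0) C0M) (exist _ (C a.+1) CaM).
  by exists a.+1, C; split=> //; apply: omega_chain_prefix Cc; apply: ltnW.
have lea0 : morse_le E M (exist _ (C a.+1) CaM) (exist _ (C 0) C0M).
  exists (l - a.+1), (fun b => C (a.+1 + b)); split.
  - by rewrite subn_gt0.
  - by apply: omega_chain_suffix Cc; apply: ltnW.
  - by rewrite addn0.
  - by rewrite subnKC // ltnW.
by have /(congr1 sval) := anti _ _ lea0 le0a.
Qed.

End Chains.

Theorem proposition3p13 (V : finType) (E : rel V) (M : {set {set V}})
    (HL : Lgraph E)
    (Hne : forall A : {set V}, A \in M -> A != set0)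
    (Hdisj : trivIset M)
    (Hinv : forall A : {set V}, A \in M -> weakly_invariant E A) :
  morse_decomposition E M <->
  recurrent_set E \subset cover M /\ is_partial_order (morse_le E M).
Proof.
split=> [[_ _ _ recM nc]|[recM [_ _ anti]]].
  split=> //; split.
  (* Reflexivity is the order axiom that draws on weak invariance. *)
  - by move=> A; apply/morse_le_refl/Hinv/(svalP A).
  - exact: morse_le_trans.
  - by move=> A B; apply: no_cycle_morse_le_anti.
by split=> //; apply: morse_le_anti_no_cycle.
Qed.
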